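(* Assume that a compact metric space $X$ is $q$-quasi-homogeneous, $q>0$. Then there is a spectral geometry $M$ on $X$ with infinite local density, $\mathrm{dens}_{\mathrm{loc}}(M)=\infty$, and dimension $\dim M\le q$. In particular, $\dim_S X\le q$.
   Context: $|xy|$ is the distance in $X$; $\Delta\subset X^2$ is the diagonal; for $z=(x,y)\in X^2$, $|z|=|xy|$; $X^2$ carries the metric $|zz'|=\max\{|xx'|,|yy'|\}$; $D_\rho(x)$ is the closed ball of radius $\rho$ about $x$. $q$-quasi-homogeneous: there is a constant $C>0$ such that for every $\delta>0$ there exists a $\delta$-net $Y_\delta\subset X$ (every point of $X$ is within distance $\le\delta$ of $Y_\delta$) such that $D_\rho(x)$ contains at most $C(\rho/\delta)^q$ points of $Y_\delta$ for every $\rho\ge\delta$ and $x\in X$. Spectral geometry (in the concrete form to which every axiomatically defined one is isomorphic): a triple $M=M(B,m)=\{\mathcal A,\mathcal H,ds\}$ where $B\subset X^2\setminus\Delta$ (the support) is symmetric under $(y,y')\mapsto(y',y)$ and $\{b\in B:|b|\ge t\}$ is finite for each $t>0$; $m:B\to\mathbb N$ is a symmetric function; $\mathcal H$ consists of square-summable sections $\xi$ on $B$, $\xi(y,y')\in\mathbb C^{m(y,y')}$; $\mathcal A$ is the algebra of Lipschitz functions on $X$ acting by $(\pi(a)\xi)(y,y')=a(y)\xi(y,y')$; $(ds\,\xi)(y,y')=|yy'|\xi(y',y)$. Local density: $\mathrm{dens}_{\mathrm{loc}}(M)=\lim_{t\to0}\ \inf_{z\in X^2\setminus\Delta,\,|z|\le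 t}\ \sup_{b\in B}|z|/|zb|$, with $|z|/0=\infty$, $\inf\emptyset=\infty$. Dixmier trace: $\omega$ is a fixed generalized limit (dilation-invariant state on bounded sequences extending the ordinary limit). For positive bounded diagonalizable $T$ with eigenvalues $\mu_0\ge\mu_1\ge\dots$ (with multiplicity, padded by zeros), $\sigma_N(T)=\sum_{n<N}\mu_n$; $\mathrm{Tr}_\omega(T)=\lim_\omega\sigma_N(T)/\log N$ if $\sigma_N(T)/\log N$ is bounded, $\infty$ otherwise. Dimension of $M$: $\dim M=\sup\{p\ge0:\mathrm{Tr}_\omega(|ds|^p)=\infty\}=\inf\{p\ge0:\mathrm{Tr}_\omega(|ds|^p)=0\}$ (with $\sup\emptyset=0$, $\inf\emptyset=\infty$; the two coincide). Spectral dimension: $\dim_S X=\lim_{D\to\infty}\inf\{\dim M: M \text{ a spectral geometry on }X,\ \mathrm{dens}_{\mathrm{loc}}(M)\ge D\}$. *)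

(* Defs.v *)
From HB Require Import structures.
From mathcomp Require Import all_boot all_order all_algebra finmap.
From mathcomp Require Import all_classical all_reals all_analysis.
From mathcomp Require Import complex.

Set Implicit Arguments.
Unset Strict Implicit.
Unset Printing Implicit Defensive.

Import Order.TTheory GRing.Theory Num.Theory.
Import numFieldNormedType.Exports.
Import Normc.

Local Open Scope classical_set_scope.
Local Open Scope ring_scope.
Local Open Scope complex_scope.

(* Supremum in [0, +oo], so that the supremum of the empty set is 0
   (ereal_sup set0 is -oo). *)
Definition sup0 {R : realType} (S : set (\bar R)) : \bar R :=
  ereal_sup ([set 0%E] `|` S).

Section Metric.
Context {R : realType} {X : metricType R}.

Definition diagonal : set (X * X) := [set z | z.1 = z.2].

Definition len (z : X * X) : R := mdist z.1 z.2.

Definition dist2 (z z' : X * X) : R :=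
  Num.max (mdist z.1 z'.1) (mdist z.2 z'.2).

Definition swap (z : X * X) : X * X := (z.2, z.1).

(* Not the library's closed_ball, which is the closure of the open ball. *)
Definition disk (rho : R) (x : X) : set X := [set y | mdist x y <= rho].

Definition is_net (delta : R) (Y : set X) : Prop :=
  forall x, exists2 y, Y y & mdist x y <= delta.

End Metric.

Definition quasi_homogeneous {R : realType} (X : metricType R) (q : R) : Prop :=
  exists2 C : R, 0 < C & forall delta : R, 0 < delta ->
    exists2 Y : set X, is_net delta Y &
      forall (rho : R) (x : X), delta <= rho ->
        finite_set (Y `&` disk rho x) /\
        (#|` fset_set (Y `&` disk rho x)|)%:R <= C * (rho / delta) `^ q.

(* Complex functions on a type T, as vectors of l^2(T). An operator is a total
   function on T -> R[i] of which only the values on a given subspace H matter. *)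
Section Hilbert.
Context {R : realType} {T : choiceType}.
Implicit Types (xi eta : T -> R[i]) (H : set (T -> R[i])).
Implicit Types A D P Q : (T -> R[i]) -> (T -> R[i]).

(* l^2(J), as the square-summable functions vanishing outside J *)
Definition ell2 (J : set T) : set (T -> R[i]) :=
  [set xi | (forall i, ~ J i -> xi i = 0) /\
            (\esum_(i in [set: T]) ((normc (xi i)) ^+ 2)%:E < +oo)%E].

(* Unordered sum of an absolutely summable family of reals *)
Definition rsum (f : T -> R) : R :=
  fine (\esum_(i in [set: T]) (EFin \o f)^\+%E i -
        \esum_(i in [set: T]) (EFin \o f)^\-%E i)%E.

Definition ip xi eta : R[i] :=
  rsum (fun i => complex.Re (xi i * conjc (eta i))) +i* rsum (fun i => complex.Im (xi i * conjc (eta i))).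

Definition hnorm xi : R := Num.sqrt (complex.Re (ip xi xi)).

Definition bounded_operator H A : Prop :=
  [/\ forall xi, H xi -> H (A xi),
      forall (c : R[i]) xi eta, H xi -> H eta ->
        A (fun i => c * xi i + eta i) = (fun i => c * A xi i + A eta i)
    & exists k : R, forall xi, H xi -> hnorm (A xi) <= k * hnorm xi].

Definition adjoint H A A' : Prop :=
  bounded_operator H A' /\
  forall xi eta, H xi -> H eta -> ip (A xi) eta = ip xi (A' eta).

Definition positive_operator H A : Prop :=
  [/\ bounded_operator H A, adjoint H A A
    & forall xi, H xi -> 0 <= ip (A xi) xi].

Definition eigenvector A (l : R) xi : Prop := A xi = (fun i => l%:C * xi i).

(* P is |D|, the positive square root of D^* D. *)
Definition is_absop H D P : Prop :=
  positive_operator H P /\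
  exists2 D', adjoint H D D' & forall xi, H xi -> P (P xi) = D' (D xi).

Definition absop H D : (T -> R[i]) -> (T -> R[i]) :=
  xget D [set P | is_absop H D P].

(* For a positive diagonalizable P, the operator P^p of the functional calculus
   is the only one with this property on H. *)
Definition is_powop H P (p : R) Q : Prop :=
  positive_operator H Q /\
  forall (l : R) xi, 0 <= l -> H xi -> eigenvector P l xi ->
    eigenvector Q (l `^ p) xi.

Definition powop H P (p : R) : (T -> R[i]) -> (T -> R[i]) :=
  xget P [set Q | is_powop H P p Q].

(* mu lists the nonzero eigenvalues of A in nonincreasing order and repeated
   according to their multiplicity, and is padded by zeros: there is an
   orthonormal system of eigenvectors, indexed by the n with mu n != 0, on the
   orthogonal complement of which A vanishes. *)
Definition is_eigenvalue_seq H A (mu : nat -> R) : Prop :=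
  [/\ forall n, 0 <= mu n,
      {homo mu : m n / (m <= n)%N >-> n <= m}
    & exists e : nat -> T -> R[i],
      [/\ forall n, mu n != 0 -> H (e n) /\ eigenvector A (mu n) (e n),
          forall m n, mu m != 0 -> mu n != 0 -> ip (e m) (e n) = (m == n)%:R
        & forall xi, H xi -> (forall n, mu n != 0 -> ip xi (e n) = 0) ->
            A xi = (fun=> 0)]].

Definition eigenvalue_seq H A : nat -> R :=
  xget (fun=> 0) [set mu | is_eigenvalue_seq H A mu].

End Hilbert.

Definition dilation {R : Type} (k : nat) (u : nat -> R) : nat -> R :=
  fun n => u (n %/ k)%N.

(* A dilation-invariant state on the bounded real sequences which extends the
   limit. *)
Record generalized_limit {R : realType} (omega : (nat -> R) -> R) : Prop := {
  glim_linear : forall (c : R) (u v : nat -> R),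
    bounded_fun u -> bounded_fun v ->
    omega (fun n => c * u n + v n) = c * omega u + omega v ;
  glim_ge0 : forall u : nat -> R,
    bounded_fun u -> (forall n, 0 <= u n) -> 0 <= omega u ;
  glim_lim : forall (u : nat -> R) (l : R), u @ \oo --> l -> omega u = l ;
  glim_dilation : forall (k : nat) (u : nat -> R),
    (0 < k)%N -> bounded_fun u -> omega (dilation k u) = omega u
}.

Section Dixmier.
Context {R : realType} {T : choiceType}.
Variable omega : (nat -> R) -> R.

(* The terms N = 0 and N = 1 are 0, since ln 0 = ln 1 = 0 and x / 0 = 0. *)
Definition dixmier_means (H : set (T -> R[i])) A : nat -> R :=
  fun N => (\sum_(n < N) eigenvalue_seq H A n) / ln N%:R.

Definition dixmier_trace (H : set (T -> R[i])) A : \bar R :=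
  if `[< bounded_fun (dixmier_means H A) >] then (omega (dixmier_means H A))%:E
  else +oo%E.

End Dixmier.

(* B is supp and m is mult; a pair of multiplicity 0 would contribute to the
   local density but not to ds, so multiplicities on the support are positive.
   The values of mult outside the support play no role. *)
Record spectral_geometry {R : realType} (X : metricType R) := SpectralGeometry {
  supp : set (X * X) ;
  mult : X * X -> nat ;
  supp_offdiag : supp `<=` ~` diagonal ;
  supp_sym : forall b, supp b -> supp (swap b) ;
  supp_fin : forall t : R, 0 < t -> finite_set [set b | supp b /\ t <= len b] ;
  mult_gt0 : forall b, supp b -> (0 < mult b)%N ;
  mult_sym : forall b, supp b -> mult (swap b) = mult b
}.

Section SpectralGeometry.
Context {R : realType} {X : metricType R}.
Variable M : spectral_geometry X.

(* xi (b, k) with k < mult b is the k-th coordinate of the value at b, a vector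
   of C^(mult b), of the section xi. *)
Definition sg_index : set (X * X * nat) :=
  [set i | supp M i.1 /\ (i.2 < mult M i.1)%N].

Definition sg_space : set (X * X * nat -> R[i]) := ell2 sg_index.

Definition sg_algebra : set (X -> R[i]) :=
  [set a | exists k : R, forall x y, normc (a x - a y) <= k * mdist x y].

Definition sg_rep (a : X -> R[i]) (xi : X * X * nat -> R[i]) :
    X * X * nat -> R[i] :=
  fun i => a i.1.1 * xi i.

Definition sg_ds (xi : X * X * nat -> R[i]) : X * X * nat -> R[i] :=
  fun i => (len i.1)%:C * xi (swap i.1, i.2).

Definition sg_absds_pow (p : R) :
    (X * X * nat -> R[i]) -> (X * X * nat -> R[i]) :=
  powop sg_space (absop sg_space sg_ds) p.

Definition sg_dim (omega : (nat -> R) -> R) : \bar R :=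
  sup0 [set p%:E | p in [set p : R | 0 <= p /\
    dixmier_trace omega sg_space (sg_absds_pow p) = +oo%E]].

(* |z|/|zb|, with the convention |z|/0 = +oo *)
Definition rel_closeness (z b : X * X) : \bar R :=
  if dist2 z b == 0 then +oo%E else (len z / dist2 z b)%:E.

Definition dens_loc_at (t : R) : \bar R :=
  ereal_inf [set sup0 [set rel_closeness z b | b in supp M]
            | z in [set z | ~ diagonal z /\ len z <= t]].

Definition dens_loc : \bar R := lim (dens_loc_at t @[t --> 0^'+]).

End SpectralGeometry.

Definition spectral_dim {R : realType} (omega : (nat -> R) -> R)
    (X : metricType R) : \bar R :=
  lim (ereal_inf [set sg_dim M omega
         | M in [set M : spectral_geometry X | (D%:E <= dens_loc M)%E]]
       @[D --> +oo%R]).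

(* Main.v *)
(* For the scales r_k = 2^-k take densities D_k = 8 (k+1)^(1/2q), which tend to
   infinity, and an (r_k/D_k)-net Y_k given by quasi-homogeneity. The support of
   M consists of the pairs of points of some Y_k at distance between r_k/4 and
   2 r_k. A pair z with r_k/2 < |z| <= r_k is then within r_k/D_k of the
   support, so the local density is infinite. There are O(r_k^-q D_k^2q) =
   O(r_k^-q (k+1)) pairs at scale k, so the sum of |b|^p over the support
   converges for p > q.

   |ds| acts on the basis vector at b as |b|. An orthonormal system of
   eigenvectors of |ds|^p consists of finitely supported functions, so Bessel's
   inequality bounds every sum of eigenvalues by the sum of |b|^p, and the
   Dixmier means are bounded for p > q. *)

Require Import Defs.
From HB Require Import structures.
From mathcomp Require Import all_boot all_order all_algebra finmap.
From mathcomp Require Import complex.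
From mathcomp Require Import all_classical all_reals all_analysis.
From mathcomp Require Import ring lra.

Set Implicit Arguments.
Unset Strict Implicit.
Unset Printing Implicit Defensive.

Import Order.TTheory GRing.Theory Num.Theory.
Import numFieldNormedType.Exports.
Import Normc.

Local Open Scope classical_set_scope.
Local Open Scope ring_scope.

(** * Unordered sums and square-summable functions *)

Section Sums.
Context {R : realType} {T : choiceType}.
Implicit Types (f : T -> R) (A : {fset T}).

Definition has_bounded_sums f : Prop :=
  exists K : R, forall A, \sum_(i <- A) f i <= K.

Lemma esum_le f (K : R) : (forall A, \sum_(i <- A) f i <= K) ->
  (\esum_(i in [set: T]) (f i)%:E <= K%:E)%E.
Proof.
move=> fK; apply: ge_ereal_sup => _ [A [finA _] <-].
by rewrite fsbig_finite//= sumEFin lee_fin.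
Qed.

Lemma le_esum_fset f A :
  ((\sum_(i <- A) f i)%:E <= \esum_(i in [set: T]) (f i)%:E)%E.
Proof.
apply: esum_ge; exists [set` A]; first by split => //; exact: finite_fset.
by rewrite fsbig_finite ?set_fsetK ?sumEFin//=; exact: finite_fset.
Qed.

Lemma bounded_sums_esum f : (forall i, 0 <= f i) ->
  has_bounded_sums f <-> (\esum_(i in [set: T]) (f i)%:E < +oo)%E.
Proof.
move=> f0; split => [[K fK]|].
  by apply: (le_lt_trans (@esum_le _ _ fK)); rewrite ltry.
have := @esum_ge0 R T setT (EFin \o f) (fun i _ => f0 i).
move=> + foo; rewrite -[X in (0 <= X)%E]/(\esum_(i in setT) (f i)%:E)%E => e0.
exists (fine (\esum_(i in [set: T]) (f i)%:E)%E) => A.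
by rewrite -lee_fin fineK ?ge0_fin_numE// le_esum_fset.
Qed.

Lemma rsum_ge0E f : (forall i, 0 <= f i) ->
  rsum f = fine (\esum_(i in [set: T]) (f i)%:E)%E.
Proof.
move=> f0; have F0 i : setT i -> (0 <= (EFin \o f) i)%E by rewrite lee_fin.
rewrite /rsum [X in (_ - X)%E]esum1 ?sube0 => [|i _].
  by congr fine; apply: eq_esum => i _; rewrite (ge0_funeposE F0)// inE.
by rewrite (ge0_funenegE F0)// inE.
Qed.

Lemma rsum_ge0 f : (forall i, 0 <= f i) -> 0 <= rsum f.
Proof.
by move=> f0; rewrite rsum_ge0E// fine_ge0// esum_ge0// => i _; rewrite lee_fin.
Qed.

Lemma rsumN f : rsum (fun i => - f i) = - rsum f.
Proof.
rewrite /rsum.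
have -> : (EFin \o (fun i => (- f i)%R))^\+%E = (EFin \o f)^\-%E.
  by apply/funext => i; rewrite funeposE funenegE.
have -> : (EFin \o (fun i => (- f i)%R))^\-%E = (EFin \o f)^\+%E.
  by apply/funext => i; rewrite funeposE funenegE/= opprK.
(* Divergent families also obey the rule, since [fine] sends both infinities to 0. *)
set p := esum _ _; set n := esum _ _.
have p0 : (0 <= p)%E by exact: esum_ge0.
have n0 : (0 <= n)%E by exact: esum_ge0.
by move: p n p0 n0 => [p||] [n||]//= _ _; rewrite ?oppr0 ?opprB.
Qed.

Lemma rsum_le f (K : R) : (forall i, 0 <= f i) ->
  (forall A, \sum_(i <- A) f i <= K) -> rsum f <= K.
Proof.
move=> f0 fK; rewrite rsum_ge0E// -lee_fin fineK; first exact: esum_le.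
rewrite ge0_fin_numE; last by apply: esum_ge0 => i _; rewrite lee_fin.
by apply/bounded_sums_esum => //; exists K.
Qed.

Lemma le_rsum f A : (forall i, 0 <= f i) -> has_bounded_sums f ->
  \sum_(i <- A) f i <= rsum f.
Proof.
move=> f0 /bounded_sums_esum foo; rewrite rsum_ge0E// -lee_fin fineK.
  exact: le_esum_fset.
rewrite ge0_fin_numE ?foo//.
by apply: esum_ge0 => i _; rewrite lee_fin.
Qed.

Lemma rsum_fset f A : (forall i, i \notin A -> f i = 0) ->
  rsum f = \sum_(i <- A) f i.
Proof.
move=> fA.
have sumA (g : T -> \bar R) : (forall i, 0 <= g i)%E ->
    (forall i, i \notin A -> g i = 0%E) ->
    (\esum_(i in [set: T]) g i = \sum_(i <- A) g i)%E.
  move=> g0 gA; rewrite -[in RHS](set_fsetK A) -fsbig_finite; last first.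
    exact: finite_fset.
  rewrite -esum_fset; [|exact: finite_fset|by move=> i _].
  rewrite [RHS]esum_mkcond; apply: eq_esum => i _.
  by case: ifPn => //; rewrite notin_setE => /negP/gA.
rewrite /rsum !sumA; first last.
- by move=> i /fA fi; rewrite funeposE/= fi max_l.
- by move=> i; exact: funepos_ge0.
- by move=> i /fA fi; rewrite funenegE/= fi oppr0 max_l.
- by move=> i; exact: funeneg_ge0.
have maxE (x y : R) : maxe x%:E y%:E = (Num.max x y)%:E by rewrite EFin_max.
under eq_bigr do rewrite funeposE/= maxE.
under [X in (_ - X)%E]eq_bigr do rewrite funenegE/= maxE.
rewrite !sumEFin/= -sumrB; apply: eq_bigr => i _.
by have [f0|f0] := leP 0 (f i); [rewrite max_r|rewrite max_l]; lra.
Qed.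

Lemma rsum_reindex (s : T -> T) f : involutive s ->
  rsum (fun i => f (s i)) = rsum f.
Proof.
move=> ss; have sbij : set_bij [set: T] [set: T] s.
  by rewrite setTT_bijective; exists s.
rewrite /rsum (reindex_esum _ _ _ (EFin \o f)^\+%E sbij).
rewrite (reindex_esum _ _ _ (EFin \o f)^\-%E sbij).
by congr (fine (_ - _)%E); apply: eq_esum => i _; rewrite ?funeposE ?funenegE.
Qed.

End Sums.

(** * Square-summable functions and their inner product *)

Section L2.
Context {R : realType} {T : choiceType}.
Implicit Types (xi eta : T -> R[i]) (A : {fset T}) (J : set T).

Lemma normc_sqrE (x : R[i]) :
  normc x ^+ 2 = complex.Re x ^+ 2 + complex.Im x ^+ 2.
Proof. by case: x => a b /=; rewrite sqr_sqrtr// addr_ge0 ?sqr_ge0. Qed.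

Lemma mul_conjc (x : R[i]) : x * conjc x = (normc x ^+ 2)%:C%C.
Proof.
by rewrite normc_sqrE; case: x => a b /=; simpc; rewrite -!expr2 mulrC addNr.
Qed.

Lemma normc_real (a : R) : normc a%:C%C = `|a|.
Proof. by rewrite /= expr0n addr0 sqrtr_sqr. Qed.

Lemma conjc_realM (a : R) (x : R[i]) :
  conjc (a%:C%C * x) = a%:C%C * conjc x.
Proof. by rewrite -[in RHS]conjc_real -rmorphM. Qed.

Lemma normcD_sqr_le (x y : R[i]) :
  normc (x + y) ^+ 2 <= 2 * normc x ^+ 2 + 2 * normc y ^+ 2.
Proof.
rewrite !normc_sqrE; case: x y => [a b] [c d] /=.
by have := sqr_ge0 (a - c); have := sqr_ge0 (b - d); nra.
Qed.

Lemma ell2P J xi : ell2 J xi <->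
  (forall i, ~ J i -> xi i = 0) /\
  has_bounded_sums (fun i => normc (xi i) ^+ 2).
Proof.
rewrite /ell2/=; split=> -[xiJ]; split=> //.
  by apply/bounded_sums_esum => // i; exact: sqr_ge0.
by apply/bounded_sums_esum => // i; exact: sqr_ge0.
Qed.

Lemma ell2_linear J c xi eta : ell2 J xi -> ell2 J eta ->
  ell2 J (fun i => c * xi i + eta i).
Proof.
move=> /ell2P[xiJ [K xiK]] /ell2P[etaJ [L etaL]]; apply/ell2P; split=> [i Ji|].
  by rewrite xiJ// etaJ// mulr0 addr0.
exists (2 * normc c ^+ 2 * K + 2 * L) => A.
apply: (@le_trans _ _ (\sum_(i <- A)
    (2 * normc c ^+ 2 * normc (xi i) ^+ 2 + 2 * normc (eta i) ^+ 2))).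
  apply: ler_sum => i _.
  by rewrite (le_trans (normcD_sqr_le _ _))// normcM exprMn mulrA.
rewrite big_split/= -!mulr_sumr lerD//.
  by rewrite ler_wpM2l// mulr_ge0// sqr_ge0.
by rewrite ler_wpM2l.
Qed.

Definition delta (i : T) : T -> R[i] := fun j => (j == i)%:R.

Lemma ell2_delta J i : J i -> ell2 J (delta i).
Proof.
move=> Ji; apply/ell2P; split=> [j Jj|].
  by rewrite /delta; case: eqP => // ji; rewrite ji in Jj.
have delta0 j : j != i -> normc (delta i j) ^+ 2 = 0.
  by move=> /negbTE ji; rewrite /delta ji mulr0n normc0 expr0n.
exists 1 => A; have [iA|iA] := boolP (i \in A).
  rewrite (bigD1_seq i)//= big1 => [|j /delta0//].
  by rewrite /delta eqxx mulr1n normc1 expr1n addr0.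
rewrite big1_seq// => j /andP[_ jA]; apply: delta0.
by apply: contraNneq iA => <-.
Qed.

Lemma sum_complexE (A : seq T) (F : T -> R[i]) : \sum_(i <- A) F i =
  ((\sum_(i <- A) complex.Re (F i)) +i* (\sum_(i <- A) complex.Im (F i)))%C.
Proof.
elim: A => [|i A IH]; first by rewrite !big_nil.
by rewrite !big_cons IH; case: (F i).
Qed.

Lemma ip_fset xi eta A : (forall i, i \notin A -> xi i * conjc (eta i) = 0) ->
  ip xi eta = \sum_(i <- A) xi i * conjc (eta i).
Proof.
move=> A0; rewrite sum_complexE /ip.
by rewrite !(@rsum_fset _ _ _ A)// => i /A0 ->.
Qed.

Lemma ip_deltar xi c i : ip xi (fun j => c * delta i j) = xi i * conjc c.
Proof.
rewrite (@ip_fset _ _ [fset i]%fset) => [|j].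
  by rewrite big_seq_fset1 /delta eqxx mulr1.
by rewrite inE /delta => /negbTE ->; rewrite mulr0 conjc0 mulr0.
Qed.

Lemma ip_delta xi i : ip xi (delta i) = xi i.
Proof.
have := ip_deltar xi 1 i; rewrite conjc1 mulr1 => <-; congr ip.
by apply/funext => j; rewrite mul1r.
Qed.

Lemma ip_conj xi eta : ip eta xi = conjc (ip xi eta).
Proof.
rewrite /ip /= -rsumN; congr (_ +i* _)%C; congr rsum; apply/funext => i.
  by case: (xi i) (eta i) => [a b] [c d] /=; ring.
by case: (xi i) (eta i) => [a b] [c d] /=; ring.
Qed.

Lemma hnormE xi : hnorm xi = Num.sqrt (rsum (fun i => normc (xi i) ^+ 2)).
Proof.
by rewrite /hnorm/=; congr (Num.sqrt (rsum _)); apply/funext => i;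
  rewrite mul_conjc.
Qed.

(** Pairing with [delta j] reads off the coordinate at [j] in [J], and outside [J] both images
    vanish. This identifies the unspecified adjoint in [is_absop]. *)
Lemma adjoint_unique J D D1 D2 eta : adjoint (ell2 J) D D1 ->
  adjoint (ell2 J) D D2 -> ell2 J eta -> D1 eta = D2 eta.
Proof.
move=> [[D1J _ _] a1] [[D2J _ _] a2] eJ; apply/funext => j.
have [Jj|Jj] := pselect (J j); last first.
  by rewrite ((D1J _ eJ).1 _ Jj) ((D2J _ eJ).1 _ Jj).
have := a1 _ _ (ell2_delta Jj) eJ; rewrite a2//; last exact: ell2_delta.
by rewrite ip_conj [RHS]ip_conj !ip_delta => /(can_inj (@conjcK _)) ->.
Qed.

(* A positive square root acts on an eigenvector of its square with eigenvalue
   [w ^+ 2] as [w]: [v = P xi - w xi] satisfies [P v = - w v], and positivity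
   of [P] leaves only [v = 0]. *)
Lemma positive_sqrt_delta J P (w : R) xi : positive_operator (ell2 J) P ->
  0 < w -> ell2 J xi -> P (P xi) = (fun j => (w ^+ 2)%:C%C * xi j) ->
  P xi = (fun j => w%:C%C * xi j).
Proof.
move=> [[PJ Plin _] _ Ppos] w0 xiJ PP.
have mwJ : ell2 J (fun j => - w%:C%C * xi j + P xi j).
  by apply: ell2_linear => //; exact: PJ.
set v := (fun j => _ + _) in mwJ.
have Pv : P v = fun j => - w%:C%C * v j.
  rewrite Plin//; last exact: PJ.
  rewrite PP; apply/funext => j; rewrite /v rmorphXn/=; ring.
have v0 i : v i = 0.
  have := Ppos _ mwJ; rewrite lecE => /andP[_] /=; rewrite Pv.
  under [X in rsum X]eq_fun do
    rewrite -mulrA mul_conjc -rmorphN -rmorphM/= mulNr.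
  rewrite rsumN oppr_ge0 => vle.
  have [K vK] := (iffLR (ell2P _ _) mwJ).2.
  have vb : has_bounded_sums (fun i => w * normc (v i) ^+ 2).
    exists (w * K) => A; rewrite -mulr_sumr ler_pM2l//.
  have := @le_rsum _ _ _ [fset i]%fset _ vb; rewrite big_seq_fset1.
  move=> /(_ (fun i => mulr_ge0 (ltW w0) (sqr_ge0 _)))/le_trans/(_ vle).
  rewrite pmulr_rle0// => vi; apply: eq0_normc; apply/eqP.
  by rewrite -sqrf_eq0 eq_le vi sqr_ge0.
apply/funext => j; apply/eqP; rewrite -subr_eq0 -[X in _ == X](v0 j) /v.
by rewrite mulNr addrC.
Qed.

End L2.

(** * The absolute value of a weighted involution and its powers *)

Section WeightedInvolution.
Context {R : realType} {T : choiceType}.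
Variables (J : set T) (w : T -> R) (s : T -> T).
Implicit Types (xi eta : T -> R[i]).

(** One form covers both [sg_ds], with [s] the swap of a pair, and the multiplication operators,
    with [s] the identity. *)
Definition winv xi : T -> R[i] := fun i => (w i)%:C%C * xi (s i).

Hypotheses (w_ge0 : forall i, 0 <= w i).
Hypotheses (sK : involutive s) (ws : forall i, w (s i) = w i).
Hypothesis (Js : forall i, J i -> J (s i)).

Lemma winv_bounded (K : R) : (forall i, w i <= K) ->
  bounded_operator (ell2 J) winv.
Proof.
move=> wK.
have sum_le xi (L : R) :
    (forall A : {fset T}, \sum_(i <- A) normc (xi i) ^+ 2 <= L) ->
    forall A : {fset T}, \sum_(i <- A) normc (winv xi i) ^+ 2 <= K ^+ 2 * L.
  move=> xiL A.
  apply: (@le_trans _ _ (\sum_(i <- A) K ^+ 2 * normc (xi (s i)) ^+ 2)).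
    apply: ler_sum => i _; rewrite /winv normcM normc_real exprMn.
    rewrite ler_wpM2r ?sqr_ge0// ger0_norm// ler_sqr ?nnegrE//.
    exact: le_trans (wK i).
  rewrite -mulr_sumr ler_wpM2l ?sqr_ge0//.
  rewrite -(big_map s xpredT (fun j => normc (xi j) ^+ 2)).
  rewrite (perm_big [fset s i | i in A]%fset) ?xiL//=.
  apply: uniq_perm; rewrite ?fset_uniq// ?map_inj_uniq ?fset_uniq//.
    exact: (can_inj sK).
  by move=> j; apply/mapP/imfsetP => -[i iA ->]; exists i.
split=> [xi|c xi eta _ _|].
- move=> /ell2P[xiJ [L xiL]]; apply/ell2P; split=> [i Ji|].
    rewrite /winv xiJ ?mulr0// => Jsi; apply: Ji.
    by rewrite -(sK i); exact: Js.
  by exists (K ^+ 2 * L); exact: sum_le.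
- by apply/funext => i; rewrite /winv mulrDr mulrCA.
- exists `|K| => xi xiJ.
  have xib := (iffLR (ell2P _ _) xiJ).2.
  rewrite !hnormE -(sqrtr_sqr K) -sqrtrM ?sqr_ge0// ler_wsqrtr//.
  apply: rsum_le => [i|]; first exact: sqr_ge0.
  by apply: sum_le => A; apply: le_rsum => // i; exact: sqr_ge0.
Qed.

(** Reindexing the sum by [s] moves the involution to the other factor; the weight follows because
    it is real and invariant under [s]. *)
Lemma winv_ip xi eta : ip (winv xi) eta = ip xi (winv eta).
Proof.
rewrite /ip /winv; congr (_ +i* _)%C.
  rewrite -[RHS](rsum_reindex _ sK); congr rsum; apply/funext => i.
  by rewrite sK ws conjc_realM; congr complex.Re; ring.
rewrite -[RHS](rsum_reindex _ sK); congr rsum; apply/funext => i.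
by rewrite sK ws conjc_realM; congr complex.Im; ring.
Qed.

Lemma winv_adjoint (K : R) : (forall i, w i <= K) ->
  adjoint (ell2 J) winv winv.
Proof.
by move=> wK; split=> [|xi eta _ _]; [exact: winv_bounded wK|exact: winv_ip].
Qed.

End WeightedInvolution.

Section AbsPow.
Context {R : realType} {T : choiceType}.
Variables (J : set T) (w : T -> R) (s : T -> T) (K : R).
Implicit Types (xi eta : T -> R[i]).

Hypotheses (w_ge0 : forall i, 0 <= w i) (wK : forall i, w i <= K).
Hypotheses (sK : involutive s) (ws : forall i, w (s i) = w i).
Hypothesis (Js : forall i, J i -> J (s i)).
Hypothesis (w_gt0 : forall i, J i -> 0 < w i).

Lemma diag_positive (v : T -> R) (L : R) : (forall i, 0 <= v i) ->
  (forall i, v i <= L) -> positive_operator (ell2 J) (winv v id).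
Proof.
move=> v0 vL; split; first exact: winv_bounded vL.
  exact: winv_adjoint vL.
move=> xi _; rewrite lecE /ip/= /winv.
rewrite (_ : (fun i => complex.Im _) = fun=> 0); last first.
  by apply/funext => i; rewrite -mulrA mul_conjc -rmorphM.
rewrite (@rsum_fset _ _ _ fset0)// big_seq_fset0 eqxx/=.
apply: rsum_ge0 => i; rewrite -mulrA mul_conjc -rmorphM/=.
by rewrite mulr_ge0// sqr_ge0.
Qed.

(** The square of [P] is [D'] after [winv w s]. By uniqueness of the adjoint it multiplies [delta i]
    by [w i ^+ 2], and positivity of [P] selects the root [w i]. *)
Lemma absop_winv P : is_absop (ell2 J) (winv w s) P ->
  forall i, J i -> P (delta i) = fun j => (w i)%:C%C * delta i j.
Proof.
move=> [Ppos [D' adjD PP]] i Ji.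
apply: (positive_sqrt_delta Ppos); [exact: w_gt0|exact: ell2_delta|].
have adjw : adjoint (ell2 J) (winv w s) (winv w s) by exact: winv_adjoint wK.
have dJ : ell2 J (winv w s (delta i)).
  by case: adjw => -[+ _ _] _; apply; exact: ell2_delta.
rewrite PP; last exact: ell2_delta.
rewrite (adjoint_unique adjD adjw dJ); apply/funext => j.
rewrite /winv sK ws mulrA -rmorphM -expr2 /delta.
by case: eqP => [->|]; rewrite ?mulr0.
Qed.

(** Self-adjointness makes the coordinate of [P xi] at [i] equal to the inner product of [xi] with
    [P (delta i)], so no basis expansion has to be passed through [P]. *)
Lemma diag_of_delta P (v : T -> R) xi : adjoint (ell2 J) P P ->
  (forall i, J i -> P (delta i) = fun j => (v i)%:C%C * delta i j) ->
  ell2 J xi -> P xi = winv v id xi.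
Proof.
move=> [[PJ _ _] Padj] Pd xiJ; apply/funext => i; rewrite /winv.
have [Ji|Ji] := pselect (J i); last first.
  by rewrite ((PJ _ xiJ).1 _ Ji) (xiJ.1 _ Ji) mulr0.
rewrite -[LHS]ip_delta Padj//; last exact: ell2_delta.
by rewrite Pd// ip_deltar conjc_real mulrC.
Qed.

(** [absop] and [powop] choose an operator with a given property. In both cases a multiplication
    operator shows that the property can be met, and the property then determines the chosen
    operator on [ell2 J]. *)
Lemma powop_winv (p : R) xi : 0 < p -> ell2 J xi ->
  powop (ell2 J) (absop (ell2 J) (winv w s)) p xi =
  winv (fun i => w i `^ p) id xi.
Proof.
move=> p0 xiJ.
have absP : is_absop (ell2 J) (winv w s) (absop (ell2 J) (winv w s)).
  apply: (@xgetPex _ _ [set P | is_absop (ell2 J) (winv w s) P]).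
  exists (winv w id); split; first exact: diag_positive wK.
  exists (winv w s); first exact: winv_adjoint wK.
  by move=> eta _; apply/funext => i; rewrite /winv sK ws.
set P := absop _ _ in absP *.
have Pdelta := absop_winv absP.
have Pdiag eta : ell2 J eta -> P eta = winv w id eta.
  by apply: diag_of_delta => //; case: absP => -[].
have powP : is_powop (ell2 J) P p (powop (ell2 J) P p).
  apply: (@xgetPex _ _ [set Q | is_powop (ell2 J) P p Q]).
  exists (winv (fun i => w i `^ p) id); split.
    apply: (@diag_positive _ (K `^ p)) => i; first exact: powR_ge0.
    by apply: ge0_ler_powR; rewrite ?nnegrE ?(ltW p0)//; exact: le_trans (wK i).
  (* An eigenvector for [l] lives where [w i = l], so there the powers of [w i] and of [l] agree. *)
  move=> l eta l0 etaJ; rewrite /eigenvector Pdiag// => Peta.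
  apply/funext => i; rewrite /winv.
  have := congr1 (fun f => f i) Peta; rewrite /winv => /eqP.
  rewrite -subr_eq0 -mulrBl mulf_eq0 subr_eq0 => /orP[/eqP/complexI ->//|].
  by move=> /eqP ->; rewrite !mulr0.
apply: diag_of_delta => //; first by case: powP => -[].
move=> i Ji; apply: powP.2; [exact: w_ge0|exact: ell2_delta|exact: Pdelta].
Qed.

End AbsPow.

(** * Traces and Dixmier means *)

Section Eigenvalues.
Context {R : realType} {T : choiceType}.
Implicit Types (J : set T) (v : T -> R).

(* Bessel's inequality for the coordinate functional at [i], with [u] the
   orthogonal projection of the basis vector at [i]: [u i] is the squared norm
   of [u], and is at most the norm. *)
Lemma bessel_coordinate (A : seq T) (I : seq nat) (e : nat -> T -> R[i]) i :
  uniq A -> uniq I -> i \in A ->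
  {in I &, forall m n, \sum_(j <- A) e m j * conjc (e n j) = (m == n)%:R} ->
  \sum_(n <- I) normc (e n i) ^+ 2 <= 1.
Proof.
move=> uA uI iA orth; set S := \sum_(n <- I) _.
pose u j := \sum_(n <- I) conjc (e n i) * e n j.
have uu : \sum_(j <- A) u j * conjc (u j) = S%:C%C.
  under eq_bigr => j _ do rewrite /u rmorph_sum/= big_distrlr/=.
  rewrite exchange_big/= rmorph_sum/= !big_seq; apply: eq_bigr => n nI.
  rewrite exchange_big/= (bigD1_seq n)//= [X in _ + X]big1_seq ?addr0.
    under eq_bigr => j _ do rewrite rmorphM/= conjcK mulrACA [conjc _ * _]mulrC.
    by rewrite -mulr_sumr orth// eqxx mulr1 mul_conjc.
  move=> m /andP[mn mI].
  under eq_bigr => j _ do rewrite rmorphM/= mulrACA.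
  by rewrite -mulr_sumr orth// eq_sym (negbTE mn) mulr0.
have ui : u i = S%:C%C.
  by rewrite /u rmorph_sum; apply: eq_bigr => n _; rewrite mulrC mul_conjc.
have S0 : 0 <= S by apply: sumr_ge0 => n _; exact: sqr_ge0.
have SS : S ^+ 2 <= S.
  rewrite -lecR -[X in _ <= X]uu (bigD1_seq i)//= ui mul_conjc normc_real.
  by rewrite ger0_norm// lerDl sumr_ge0// => j _; exact: mulcJ_ge0.
nra.
Qed.

(** An infinite level set would contain a finite set of more than [K / t] points, whose sum exceeds
    [K]. *)
Lemma finite_level_set J v (K t : R) :
  (forall A : {fset T}, [set` A] `<=` J -> \sum_(i <- A) v i <= K) ->
  0 < t -> finite_set [set i | J i /\ t <= v i].
Proof.
move=> vK t0; apply: contrapT => inf.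
have [B BJ Bn] := infinite_set_fset (Num.truncn (K / t)).+1 inf.
have : t *+ #|` B| <= K.
  apply: le_trans (vK B _); last by move=> i /BJ[].
  rewrite -iter_addr_0 -[iter _ _ _]/(iter (size (enum_fset B)) _ _).
  rewrite -count_predT -big_const_seq big_seq [leRHS]big_seq.
  by apply: ler_sum => i /BJ[].
apply/negP; rewrite -ltNge -mulr_natr mulrC -ltr_pdivrMr//.
by rewrite (lt_le_trans (truncnS_gt _))// ler_nat.
Qed.

(** A unit eigenvector [e n] lives where [v] equals [mu n], so [mu n] is the mean of [v] with
    weights the squared moduli of [e n i]. Summed over [n] at a fixed [i], these weights are at most
    1 by Bessel's inequality. *)
Lemma eigenvalue_sum_le J v (K : R) Q mu (N : nat) :
  (forall i, 0 <= v i) ->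
  (forall A : {fset T}, [set` A] `<=` J -> \sum_(i <- A) v i <= K) ->
  (forall xi, ell2 J xi -> Q xi = winv v id xi) ->
  is_eigenvalue_seq (ell2 J) Q mu -> \sum_(n < N) mu n <= K.
Proof.
move=> v0 vK Qv [mu0 _ [e [eig orth _]]].
pose I := [seq n <- iota 0 N | mu n != 0].
have -> : \sum_(n < N) mu n = \sum_(n <- I) mu n.
  rewrite big_filter -[LHS](big_mkord xpredT mu) /index_iota subn0.
  rewrite [LHS](bigID (fun n => mu n != 0))/= [X in _ + X]big1 ?addr0//.
  by move=> n /negPn/eqP.
have muI n : n \in I -> mu n != 0 by rewrite mem_filter => /andP[].
have evals n i : n \in I -> e n i != 0 -> J i /\ v i = mu n.
  move=> /muI /eig[eJ een] ei; split.
    by apply: contrapT => /eJ.1 /eqP; rewrite (negbTE ei).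
  have := congr1 (fun f => f i) een; rewrite Qv// /winv => /eqP.
  by rewrite -subr_eq0 -mulrBl mulf_eq0 (negbTE ei) orbF subr_eq0 =>
    /eqP/complexI.
(* Level sets of [v] at positive heights are finite, so the eigenvectors indexed by [I] all vanish
   outside one finite set and their inner products are finite sums. *)
pose supps := \bigcup_(n in [set` I]) [set i | e n i != 0].
have fin : finite_set supps.
  apply: bigcup_finite => [|n nI]; first exact: finite_seq.
  have mu_gt0 : 0 < mu n by rewrite lt_neqAle eq_sym mu0 muI.
  apply: sub_finite_set (finite_level_set vK mu_gt0) => i /=.
  by move=> /(evals _ _ nI)[Ji <-].
pose A := fset_set supps.
have Asupp i n : n \in I -> i \notin A -> e n i = 0.
  move=> nI; rewrite /A in_fset_set// notin_setE => iA.
  by apply/eqP; apply: contrapT => /negP ei; apply: iA; exists n.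
have ortho : {in I &, forall m n,
    \sum_(j <- A) e m j * conjc (e n j) = (m == n)%:R}.
  move=> m n mI nI; rewrite -orth ?muI// (@ip_fset _ _ _ _ A)// => i iA.
  by rewrite (Asupp _ _ mI iA) mul0r.
have mass n : n \in I -> \sum_(i <- A) normc (e n i) ^+ 2 = 1.
  move=> nI; apply: complexI; rewrite rmorph_sum/=.
  under eq_bigr do rewrite -mul_conjc.
  by rewrite ortho// eqxx.
apply: (@le_trans _ _ (\sum_(i <- A) v i)); last first.
  apply: vK => i; rewrite /= in_fset_set// inE => -[n nI].
  by move=> /(evals _ _ nI)[].
apply: (@le_trans _ _ (\sum_(i <- A) v i * \sum_(n <- I) normc (e n i) ^+ 2)).
  under [leRHS]eq_bigr do rewrite mulr_sumr.
  rewrite exchange_big/= le_eqVlt; apply/orP; left; apply/eqP.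
  rewrite !big_seq; apply: eq_bigr => n nI.
  rewrite -[LHS]mulr1 -(mass _ nI) mulr_sumr; apply: eq_bigr => i _.
  have [->|/(evals _ _ nI)[_ ->//]] := eqVneq (e n i) 0.
  by rewrite normc0 expr0n/= !mulr0.
rewrite big_seq [leRHS]big_seq; apply: ler_sum => i iA.
rewrite -[leRHS]mulr1 ler_wpM2l//.
apply: (bessel_coordinate _ _ iA ortho); first exact: fset_uniq.
by rewrite filter_uniq// iota_uniq.
Qed.

End Eigenvalues.

(** * Finite Dixmier traces and the dimension bound *)

Section Dimension.
Context {R : realType}.

Lemma dixmier_trace_fin (T : choiceType) (omega : (nat -> R) -> R)
    (H : set (T -> R[i])) Q (K : R) :
  (forall mu, is_eigenvalue_seq H Q mu ->
    forall N : nat, \sum_(n < N) mu n <= K) ->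
  dixmier_trace omega H Q <> +oo%E.
Proof.
move=> muK; rewrite /dixmier_trace asboolT//.
(* The maximum with 0 covers an operator without eigenvalue sequence, for which [eigenvalue_seq]
   defaults to zero. *)
have sumQ N : 0 <= \sum_(n < N) eigenvalue_seq H Q n <= Num.max 0 K.
  rewrite /eigenvalue_seq; set mu := xget _ _.
  have [exmu|nomu] := pselect (exists mu', is_eigenvalue_seq H Q mu').
    have muP : is_eigenvalue_seq H Q mu.
      exact: (@xgetPex _ _ [set mu | is_eigenvalue_seq H Q mu]).
    by rewrite sumr_ge0 => [|n _]; [rewrite le_max muK ?orbT|case: muP].
  rewrite big1 ?lexx ?le_max ?lexx// => n _.
  by rewrite /mu xgetPN// => mu' mu'P; apply: nomu; exists mu'.
have ln2 : 0 < ln 2 :> R by rewrite ln_gt0// ltr1n.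
(* For [N] at least 2 the denominator is at least [ln 2]; for smaller [N] it is 0, and so is the
   mean. *)
exists (Num.max 0 K / ln 2); split=> [|B KB N _]; first exact: num_real.
apply: le_trans (ltW KB); rewrite /dixmier_means.
have /andP[S0 SK] := sumQ N.
have [N2|N2] := leqP 2 N.
  have lnN : ln 2 <= ln N%:R :> R.
    by rewrite ler_ln ?posrE ?ltr0n ?ler_nat//; exact: leq_trans N2.
  have lnN0 : 0 < ln N%:R :> R by exact: lt_le_trans lnN.
  rewrite ger0_norm ?divr_ge0 ?(ltW lnN0)//.
  apply: ler_pM => //; first by rewrite invr_ge0 ltW.
  by rewrite lef_pV2 ?posrE.
have -> : ln N%:R = 0 :> R.
  by case: N N2 {S0 SK} => [|[|]]//; rewrite ?ln1 ?ln0.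
by rewrite invr0 mulr0 normr0 divr_ge0 ?(ltW ln2)// le_max lexx.
Qed.

Lemma sg_dim_le (X : metricType R) (M : spectral_geometry X)
    (omega : (nat -> R) -> R) (L q : R) :
  (forall x y : X, mdist x y <= L) -> 0 <= q ->
  (forall p, q < p -> exists K : R, forall A : {fset X * X * nat},
    [set` A] `<=` sg_index M -> \sum_(i <- A) len i.1 `^ p <= K) ->
  (sg_dim M omega <= q%:E)%E.
Proof.
(* The first case is the 0 adjoined by [sup0]; the second excludes every exponent above [q]. *)
move=> XL q0 sumM; apply: ge_ereal_sup => _ [->|[p [p0 trp] <-]].
  by rewrite lee_fin.
rewrite lee_fin leNgt; apply/negP => qp; move: trp.
have [K AK] := sumM _ qp.
apply: (@dixmier_trace_fin _ _ _ _ K) => mu muP N.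
have v0 (i : X * X * nat) : 0 <= len i.1 `^ p by exact: powR_ge0.
apply: (eigenvalue_sum_le N v0 AK _ muP).
move=> xi xiJ; rewrite /sg_absds_pow.
have -> : sg_ds = winv (fun i : X * X * nat => len i.1)
    (fun i => (swap i.1, i.2)).
  by [].
apply: (@powop_winv _ _ _ _ _ L) => //.
- by move=> i; exact: mdist_ge0.
- by move=> i; exact: XL.
- by move=> [[x y] n].
- by move=> [[x y] n]; rewrite /len/= metric_sym.
- by move=> [b n] [/= Mb nb]; split=> /=; [exact: supp_sym|rewrite mult_sym].
- move=> [b n] [/= Mb _]; rewrite /len mdist_gt0.
  by apply/eqP => bb; exact: (supp_offdiag Mb).
- exact: le_lt_trans qp.
Qed.

End Dimension.

(** * The geometry built from nets *)

Section MetricCounting.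
Context {R : realType}.

(** The distance to [x0] is bounded on each unit ball, hence on [X] by compactness. The bound is
    taken at least 1 so that it exceeds every mesh used later. *)
Lemma compact_mdist_bounded (X : metricType R) : compact [set: X] ->
  exists2 L : R, 1 <= L & forall x y : X, mdist x y <= L.
Proof.
move=> /compact_near_coveringP cX.
have [[x0 _]|X0] := pselect (exists x : X, True); last first.
  by exists 1 => // x; exfalso; apply: X0; exists x.
have : \forall L \near +oo, [set: X] `<=` (fun x => mdist x0 x <= L).
  apply: cX => x _.
  exists (ball x 1, [set L | mdist x0 x + 1 <= L]) => /=.
    by split; [exact: nbhsx_ballx|exact: (nbhs_pinfty_ge (num_real _))].
  move=> [y L] /= []; rewrite ballEmdist/= => xy; apply: le_trans.
  by rewrite (le_trans (metric_triangle _ x _))// lerD2l ltW.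
move=> /(filterI (nbhs_pinfty_ge (num_real 1))) /filter_ex [L [/= L1 XL]].
exists (L + L) => [|x y]; first by lra.
rewrite (le_trans (metric_triangle _ x0 _))// lerD//; last exact: XL.
by rewrite metric_sym; exact: XL.
Qed.

Lemma near_pairs_cover (X : metricType R) (Y : set X) (rho a b : R) :
  0 <= b -> finite_set Y -> #|` fset_set Y|%:R <= a ->
  (forall x, finite_set (Y `&` disk rho x) /\
             #|` fset_set (Y `&` disk rho x)|%:R <= b) ->
  exists2 s : seq (X * X), (size s)%:R <= a * b &
    forall z, Y z.1 -> Y z.2 -> len z <= rho -> z \in s.
Proof.
move=> b0 finY Ya Yb.
exists [seq (y, y') | y <- fset_set Y, y' <- fset_set (Y `&` disk rho y)].
  rewrite size_allpairs_dep sumnE big_map natr_sum.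
  apply: (@le_trans _ _ (\sum_(y <- fset_set Y) b)).
    by apply: ler_sum => y _; have [_] := Yb y.
  rewrite big_const_seq count_predT iter_addr_0 -mulr_natl ler_wpM2r//.
move=> [y y'] /= Yy Yy' yy'; apply/allpairsPdep; exists y, y'; split=> //.
  by rewrite in_fset_set// inE.
by rewrite in_fset_set ?inE//; have [] := Yb y.
Qed.

(** The lists may overlap, so each [b] is charged to one chosen index [kap b]; index [k] is then
    charged at most [size (s k)] times. *)
Lemma sum_le_cover (T : choiceType) (A : {fset T}) (f : T -> R)
    (c : nat -> R) (s : nat -> seq T) (K : R) :
  (forall k, 0 <= c k) ->
  (forall b, b \in A -> exists2 k, b \in s k & f b <= c k) ->
  (forall n : nat, \sum_(k < n) (size (s k))%:R * c k <= K) ->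
  \sum_(b <- A) f b <= K.
Proof.
move=> c0 fc sK.
have [kap kapP] : exists kap : T -> nat,
    forall b, b \in A -> b \in s (kap b) /\ f b <= c (kap b).
  have /choice[kap kapP] : forall b, exists k,
      b \in A -> b \in s k /\ f b <= c k.
    move=> b; have [/fc[k]|] := boolP (b \in A); first by exists k.
    by exists 0%N.
  by exists kap.
pose n := (\max_(b <- A) kap b).+1.
apply: le_trans (sK n).
apply: (@le_trans _ _ (\sum_(k < n) \sum_(b <- A | kap b == k) c k)).
  rewrite (exchange_big_dep xpredT)//= big_seq [leRHS]big_seq.
  apply: ler_sum => b bA.
  have kn : (kap b < n)%N by rewrite ltnS; exact: leq_bigmax_seq.
  rewrite (big_pred1 (Ordinal kn)) => [|k]; first by have [] := kapP _ bA.
  by rewrite /= eq_sym.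
apply: ler_sum => k _.
rewrite -big_filter big_const_seq count_predT iter_addr_0 -[leLHS]mulr_natl.
rewrite ler_wpM2r// ler_nat uniq_leq_size ?filter_uniq ?fset_uniq// => b.
by rewrite mem_filter => /andP[/eqP <- /kapP[]].
Qed.

(** The bound is the value of the infinite series, the derivative of the geometric one. The proof
    compares it with the closed form of the partial sum. *)
Lemma sum_succ_expr_le (a : R) (n : nat) : 0 <= a -> a < 1 ->
  \sum_(k < n) k.+1%:R * a ^+ k <= ((1 - a) ^+ 2)^-1.
Proof.
move=> a0 a1; have a2 : 0 < (1 - a) ^+ 2 by rewrite exprn_gt0// subr_gt0.
rewrite -[leRHS]mul1r ler_pdivlMr//.
have -> : (\sum_(k < n) k.+1%:R * a ^+ k) * (1 - a) ^+ 2 =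
    1 - n.+1%:R * a ^+ n + n%:R * a ^+ n.+1.
  elim: n => [|n IH]; first by rewrite big_ord0 !expr0 mul0r; lra.
  by rewrite big_ord_recr/= mulrDl IH !exprS -!natr1; ring.
have an : 0 <= a ^+ n by rewrite exprn_ge0.
have nn : 0 <= n%:R :> R by [].
rewrite exprS -natr1.
have : n%:R * (a * a ^+ n) <= n%:R * a ^+ n.
  by rewrite ler_wpM2l// ler_piMl// ltW.
lra.
Qed.

Lemma half_expr_lt (t : R) : 0 < t -> exists n : nat, 2^-1 ^+ n < t.
Proof.
move=> t0; exists (Num.truncn t^-1).+1.
rewrite exprVn -[ltRHS]invrK ltf_pV2 ?posrE ?invr_gt0 ?exprn_gt0//.
apply: (lt_le_trans (truncnS_gt _)).
by rewrite -natrX ler_nat ltnW// ltn_expl.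
Qed.

End MetricCounting.

(** * The support, its summability and its local density *)

Section NetGeometry.
Context {R : realType} {X : metricType R}.
Variables (q C L : R) (Y : nat -> set X).

Definition scale (k : nat) : R := 2^-1 ^+ k.

(** The exponent makes the power [2 * q] of the density linear in [k.+1]; the factor 8 keeps the
    mesh within an eighth of the scale. *)
Definition density (k : nat) : R := 8 * k.+1%:R `^ (2 * q)^-1.

Definition mesh (k : nat) : R := scale k / density k.

(** A pair with length between [scale k / 2] and [scale k] stays within these bounds when each end
    moves by at most [scale k / 8]. *)
Definition scale_pairs (k : nat) : set (X * X) :=
  [set b | [/\ Y k b.1, Y k b.2, scale k / 4 <= len b & len b <= 2 * scale k]].

Hypotheses (q0 : 0 < q) (C0 : 0 < C) (L1 : 1 <= L).
Hypothesis XL : forall x y : X, mdist x y <= L.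
Hypothesis Ynet : forall k, is_net (mesh k) (Y k).
Hypothesis Ycard : forall k (rho : R) (x : X), mesh k <= rho ->
  finite_set (Y k `&` disk rho x) /\
  #|` fset_set (Y k `&` disk rho x)|%:R <= C * (rho / mesh k) `^ q.

Lemma scale_gt0 k : 0 < scale k.
Proof. by rewrite exprn_gt0// invr_gt0. Qed.

Lemma scale_le1 k : scale k <= 1.
Proof. by rewrite exprn_ile1 ?invr_ge0// invf_le1// ler1n. Qed.

Lemma scaleS k : scale k.+1 = scale k / 2.
Proof. by rewrite /scale exprSr. Qed.

Lemma scale_lt_inv m n : scale m < scale n -> (n < m)%N.
Proof.
apply: contraTT; rewrite -leqNgt -leNgt => mn.
by apply: ler_wiXn2l => //; rewrite ?invr_ge0// invf_le1// ler1n.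
Qed.

Lemma density_ge8 k : 8 <= density k.
Proof.
rewrite /density -[leLHS]mulr1 ler_wpM2l//.
rewrite -[leLHS](powRr0 (k.+1%:R : R)) ler_powR ?ler1n//.
by rewrite invr_ge0 mulr_ge0// ltW.
Qed.

Lemma density_gt0 k : 0 < density k.
Proof. exact: lt_le_trans (density_ge8 k). Qed.

Lemma mesh_gt0 k : 0 < mesh k.
Proof. by rewrite divr_gt0 ?scale_gt0 ?density_gt0. Qed.

Lemma mesh_le k : mesh k <= scale k / 8.
Proof.
rewrite /mesh ler_pM2l ?scale_gt0// lef_pV2 ?posrE ?density_gt0//.
exact: density_ge8.
Qed.

(** The space is a disk of radius [L] about any of its points, so the disk bound counts the whole
    net. The empty space has no centre and is treated apart. *)
Lemma net_card k : finite_set (Y k) /\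
  #|` fset_set (Y k)|%:R <= C * (L / mesh k) `^ q.
Proof.
have [[x _]|X0] := pselect (exists x : X, True); last first.
  have -> : Y k = set0.
    by apply/seteqP; split=> // x _; apply: X0; exists x.
  by rewrite fset_set0 cardfs0; split=> //;
    rewrite mulr_ge0 ?powR_ge0 ?(ltW C0).
have mL : mesh k <= L.
  by have := mesh_le k; have := scale_le1 k; move: L1; lra.
have := Ycard x mL; rewrite (_ : Y k `&` disk L x = Y k)//.
by apply/setIidPl => y _; exact: XL.
Qed.

(** The first point ranges over the net, the second over a disk of radius [2 * scale k]. The product
    of the two counts contains the density to the power [2 * q], which yields the factor [k.+1]; the
    constant 128 is 2 times the square of 8. *)
Lemma scale_pairs_cover k : exists2 s : seq (X * X),
  (size s)%:R <= C ^+ 2 * (128 * L) `^ q * k.+1%:R * (scale k)^-1 `^ q &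
  forall b, scale_pairs k b -> b \in s.
Proof.
have r0 := scale_gt0 k; have m0 := mesh_gt0 k; have d0 := density_gt0 k.
have [Yfin YL] := net_card k.
have m2r : mesh k <= 2 * scale k by have := mesh_le k; lra.
have b0 : 0 <= C * ((2 * scale k) / mesh k) `^ q.
  by rewrite mulr_ge0 ?powR_ge0 ?(ltW C0).
have [s ss sP] := near_pairs_cover b0 Yfin YL (fun x => Ycard x m2r).
exists s; last by move=> b [Y1 Y2 _ b2]; exact: sP.
apply: (le_trans ss); rewrite le_eqVlt; apply/orP; left; apply/eqP.
have L0 : 0 <= L by apply: le_trans L1.
rewrite mulrACA -expr2 -[RHS]mulrA -[RHS]mulrA; congr (_ * _).
rewrite -powRM ?mulr_ge0 ?invr_ge0 ?(ltW m0) ?(ltW r0)//.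
set x : R := k.+1%:R `^ (2 * q)^-1.
have x0 : 0 < x by rewrite powR_gt0.
have -> : L / mesh k * (2 * scale k / mesh k) =
    (128 * L) * ((x * x) * (scale k)^-1).
  rewrite /mesh /density -/x; field.
  by rewrite !gt_eqF.
rewrite powRM ?mulr_ge0 ?invr_ge0 ?(ltW x0) ?(ltW r0)//; congr (_ * _).
rewrite powRM ?mulr_ge0 ?invr_ge0 ?(ltW x0) ?(ltW r0)//; congr (_ * _).
rewrite powRM ?(ltW x0)// /x -powRrM -powRD; last first.
  by rewrite pnatr_eq0 implybT.
rewrite (_ : _ + _ = 1) ?powRr1//; field; exact: lt0r_neq0.
Qed.

Definition net_supp : set (X * X) := \bigcup_k scale_pairs k.

Lemma net_supp_offdiag : net_supp `<=` ~` diagonal.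
Proof.
move=> b [k _ [_ _ kb _]] bb; move: kb.
rewrite /len (_ : b.1 = b.2)// mdistxx leNgt divr_gt0 ?scale_gt0//.
Qed.

Lemma net_supp_sym b : net_supp b -> net_supp (swap b).
Proof.
by move=> [k _ [Y1 Y2 kb bk]]; exists k => //; split=> //;
  rewrite /len metric_sym.
Qed.

Lemma net_supp_fin (t : R) : 0 < t ->
  finite_set [set b | net_supp b /\ t <= len b].
Proof.
(* Pairs at scale [k] have length at most [2 * scale k], so only scales of index below [n] reach
   length [t]. *)
move=> t0; have [n nt] : exists n, scale n < t / 2.
  by apply: half_expr_lt; rewrite divr_gt0.
apply: (@sub_finite_set _ _ (\bigcup_(k in `I_n) scale_pairs k)).
  move=> b [[k _ kb] tb]; exists k => //=; apply: scale_lt_inv.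
  by case: kb => _ _ _; lra.
apply: bigcup_finite => // k _; have [s _ sP] := scale_pairs_cover k.
by apply: sub_finite_set (finite_seq s) => b; exact: sP.
Qed.

Definition net_geometry : spectral_geometry X :=
  @SpectralGeometry R X net_supp (fun=> 1%N) net_supp_offdiag net_supp_sym
    net_supp_fin (fun _ _ => isT) (fun _ _ => erefl).

(** Scale [k] contributes at most a constant times [k.+1] times the power [p - q] of [scale k], and
    that power is geometric in [k] with ratio below 1. *)
Lemma net_geometry_summable (p : R) : q < p -> exists K : R,
  forall A : {fset X * X * nat}, [set` A] `<=` sg_index net_geometry ->
    \sum_(i <- A) len i.1 `^ p <= K.
Proof.
move=> qp; have p0 : 0 < p by exact: lt_trans qp.
have /choice[s sP] k : exists s : seq (X * X),
    (size s)%:R <= C ^+ 2 * (128 * L) `^ q * k.+1%:R * (scale k)^-1 `^ q /\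
    forall b, scale_pairs k b -> b \in s.
  by have [s] := scale_pairs_cover k; exists s.
pose E := C ^+ 2 * (128 * L) `^ q.
have E0 : 0 <= E by rewrite mulr_ge0 ?sqr_ge0 ?powR_ge0.
pose a : R := 2^-1 `^ (p - q).
have a0 : 0 <= a by exact: powR_ge0.
have a1 : a < 1.
  have <- : 1 `^ (p - q) = 1 :> R by rewrite powR1.
  by rewrite /a gt0_ltr_powR ?nnegrE ?subr_gt0 ?invr_ge0 ?invf_lt1 ?ltr1n.
exists (E * 2 `^ p * ((1 - a) ^+ 2)^-1) => A AM.
(* All multiplicities are 1, so a pair occurs only with coordinate index 0. *)
apply: (@sum_le_cover _ _ _ _ (fun k => (2 * scale k) `^ p)
  (fun k => [seq (b, 0%N) | b <- s k])) => [k|[b m] /AM[/= [k _ kb]]|n].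
- exact: powR_ge0.
- rewrite ltnS leqn0 => /eqP ->; exists k.
    by apply/mapP; exists b => //; exact: (sP k).2.
  have r0 := scale_gt0 k; case: kb => _ _ _ b2.
  apply: ge0_ler_powR => //; first exact: ltW p0.
    by rewrite nnegrE mdist_ge0.
  by rewrite nnegrE mulr_ge0 ?(ltW r0).
- apply: (@le_trans _ _ (\sum_(k < n) E * 2 `^ p * (k.+1%:R * a ^+ k))).
    apply: ler_sum => k _; rewrite size_map.
    have r0 := scale_gt0 k.
    apply: (le_trans (ler_wpM2r (powR_ge0 _ _) (sP k).1)); rewrite -/E.
    rewrite powRM ?(ltW r0)// le_eqVlt; apply/orP; left; apply/eqP.
    have -> : a ^+ k = scale k `^ (p - q).
      by rewrite /a /scale -!powR_mulrn ?powR_ge0 ?invr_ge0// -!powRrM mulrC.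
    have -> : scale k `^ p = scale k `^ q * scale k `^ (p - q).
      rewrite -powRD; first by congr (_ `^ _); ring.
      by rewrite (gt_eqF r0) implybT.
    have rr : (scale k)^-1 `^ q * scale k `^ q = 1.
      by rewrite -powRM ?invr_ge0 ?(ltW r0)// mulVf ?gt_eqF// powR1.
    by ring: rr.
  by rewrite -mulr_sumr ler_wpM2l ?(mulr_ge0 E0) ?powR_ge0// sum_succ_expr_le.
Qed.

Lemma scale_of_len (l : R) k0 : 0 < l -> l <= scale k0 ->
  exists2 k, (k0 <= k)%N & scale k / 2 < l <= scale k.
Proof.
move=> l0 lk0; have exl : exists n, scale n < l by exact: half_expr_lt.
(* The least index with [scale n < l] is not 0, because [l] is at most 1; its predecessor is the
   required scale. *)
case: (ex_minnP exl) => -[|k] kl kmin.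
  by move: kl; rewrite ltNge /scale expr0 (le_trans lk0)// scale_le1.
exists k.
  by rewrite -ltnS; apply: scale_lt_inv; exact: lt_le_trans kl lk0.
by rewrite -scaleS kl/= leNgt; apply/negP => /kmin; rewrite ltnn.
Qed.

Lemma density_unbounded (A : R) : exists k0, forall k, (k0 <= k)%N ->
  A <= density k / 2.
Proof.
(* The power [2 * q] inverts the exponent in [density]. *)
exists (Num.truncn (`|A| `^ (2 * q))) => k kk.
have q20 : 0 < 2 * q by rewrite mulr_gt0.
have Ak : `|A| <= k.+1%:R `^ (2 * q)^-1.
  have -> : `|A| = (`|A| `^ (2 * q)) `^ (2 * q)^-1.
    by rewrite -powRrM mulfV ?powRr1 ?lt0r_neq0.
  apply: ge0_ler_powR; rewrite ?nnegrE ?powR_ge0 ?invr_ge0 ?(ltW q20)//.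
  by rewrite ltW// (lt_le_trans (truncnS_gt _))// ler_nat.
have := ler_norm A; have := normr_ge0 A; rewrite /density; lra.
Qed.

(** Both ends of [z] move to net points by at most [mesh k], while [z] is longer than [scale k / 2];
    the quotient of these lengths is half the density. *)
Lemma net_geometry_close k (z : X * X) : scale k / 2 < len z <= scale k ->
  exists2 b, net_supp b & ((density k / 2)%:E <= rel_closeness z b)%E.
Proof.
move=> /andP[kz zk]; have [y1 Y1 zy1] := Ynet k z.1.
have [y2 Y2 zy2] := Ynet k z.2.
have mk := mesh_le k; have r0 := scale_gt0 k.
exists (y1, y2).
  exists k => //; split=> //=; rewrite /len/= in kz zk *.
    have := metric_triangle z.1 y1 z.2; have := metric_triangle y1 y2 z.2.
    rewrite (metric_sym y2 z.2); lra.
  have := metric_triangle y1 z.1 y2; have := metric_triangle z.1 z.2 y2.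
  rewrite (metric_sym y1 z.1); lra.
rewrite /rel_closeness; case: ifPn => [_|d0]; first exact: leey.
have dm : dist2 z (y1, y2) <= mesh k by rewrite ge_max zy1 zy2.
have {}d0 : 0 < dist2 z (y1, y2).
  by rewrite lt_neqAle eq_sym d0 le_max mdist_ge0.
rewrite lee_fin ler_pdivlMr// (le_trans (ler_wpM2l _ dm))//.
  by rewrite divr_ge0// ltW// density_gt0.
by rewrite /mesh mulrCA mulrAC mulfV ?mul1r ?ltW// gt_eqF// density_gt0.
Qed.

Lemma net_geometry_dens_loc : dens_loc net_geometry = +oo%E.
Proof.
apply: cvg_lim => //; apply/cvgeyPge => A.
have [k0 k0A] := density_unbounded A.
near=> t.
apply: le_ereal_inf_tmp => _ [z [zd zt] <-].
have z0 : 0 < len z by rewrite /len mdist_gt0; apply/eqP.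
(* For such [t] every competing pair has scale index at least [k0], where half the density is at
   least [A]. *)
have tk : t <= scale k0 by near: t; apply: nbhs_right_le; exact: scale_gt0.
have [k kk zk] := scale_of_len z0 (le_trans zt tk).
have [b Mb zb] := net_geometry_close zk.
apply: (@le_trans _ _ (density k / 2)%:E); first by rewrite lee_fin k0A.
apply: (le_trans zb); apply: ereal_sup_ubound; right.
by exists b.
Unshelve. all: by end_near. Qed.

End NetGeometry.

(** * The spectral dimension and the conclusion *)

Lemma spectral_dim_le (R : realType) (omega : (nat -> R) -> R)
    (X : metricType R) (M : spectral_geometry X) (q : R) :
  dens_loc M = +oo%E -> (sg_dim M omega <= q%:E)%E ->
  (spectral_dim omega X <= q%:E)%E.
Proof.
move=> Moo Mq; rewrite /spectral_dim.
set f := fun D : R => ereal_inf _.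
(* Raising the density threshold leaves fewer geometries, so the infima are nondecreasing and their
   limit is a supremum. [M] competes at every threshold. *)
have ndf : {homo f : x y / x <= y >-> (x <= y)%E}.
  move=> D1 D2 D12; apply: ereal_inf_le_tmp => _ [M' MD <-].
  by exists M' => //=; apply: le_trans MD; rewrite lee_fin.
rewrite (cvg_lim _ (nondecreasing_cvge ndf))//.
apply: ge_ereal_sup => _ [D _ <-]; apply: le_trans Mq.
by apply: ereal_inf_lbound; exists M => //=; rewrite Moo leey.
Qed.

Theorem theorem4p9 (R : realType) (omega : (nat -> R) -> R)
    (X : metricType R) (q : R)
    (homega : generalized_limit omega) (hX : compact [set: X])
    (hq : 0 < q) (hqh : quasi_homogeneous X q) :
  (exists M : spectral_geometry X,
     dens_loc M = +oo%E /\ (sg_dim M omega <= q%:E)%E) /\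
  (spectral_dim omega X <= q%:E)%E.
Proof.
have [L L1 XL] := compact_mdist_bounded hX.
have [C C0 Ynets] := hqh.
(* [C] is fixed before the radius, so the nets chosen for all scales share it. *)
have /choice[Y Yk] k : exists Y : set X, is_net (mesh q k) Y /\
    forall (rho : R) x, mesh q k <= rho -> finite_set (Y `&` disk rho x) /\
      #|` fset_set (Y `&` disk rho x)|%:R <= C * (rho / mesh q k) `^ q.
  by have [Y Y1 Y2] := Ynets _ (mesh_gt0 hq k); exists Y.
pose M := net_geometry hq C0 L1 XL (fun k => (Yk k).2).
have Moo : dens_loc M = +oo%E.
  by apply: net_geometry_dens_loc => k; exact: (Yk k).1.
have Mq : (sg_dim M omega <= q%:E)%E.
  by apply: (sg_dim_le _ XL (ltW hq)) => p; exact: net_geometry_summable.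
by split; [exists M|exact: spectral_dim_le Moo Mq].
Qed.
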